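(* Let $\mathcal C$ be a strong balanced factorization category and $X$ an object of $\mathcal C$. For every point $x:1\to X$ there is a bicartesian arrow $\uparrow_X x\to{\downarrow_X} x$ for the bimodule $\mathrm{ten}_X$; that is, there is a bicartesian element of $\mathrm{ten}_X(\uparrow_X x,\downarrow_X x)$.
   Context: A balanced factorization category (bfc) is a finitely complete category $\mathcal C$ with two (orthogonal) factorization systems $(\mathcal E,\mathcal M)$ and $(\mathcal E',\mathcal M')$ satisfying the reciprocal stability law: the pullback of a map in $\mathcal E$ along a map in $\mathcal M'$ is in $\mathcal E$, and the pullback of a map in $\mathcal E'$ along a map in $\mathcal M$ is in $\mathcal E'$. $\mathcal M/X$ (resp. $\mathcal M'/X$) is the full subcategory of $\mathcal C/X$ on the objects lying in $\mathcal M$ (resp. $\mathcal M'$). The bfc is strong if $\mathcal M/1=\mathcal M'/1$; this category is denoted $\mathcal S$, and $\pi_0:\mathcal C\to\mathcal S$ is the left adjoint of the inclusion $\mathcal S\hookrightarrow\mathcal C$. For $x:1\to X$, $\downarrow_X x\in\mathcal M/X$ (the slice projection $X/x\to X$) is the second factor of an $(\mathcal E,\mathcal M)$-factorization of $x$, and $\uparrow_X x\in\mathcal M'/X$ (the coslice projection $x\backslash X\to X$) is the second factor of an $(\mathcal E',\mathcal M')$-factorization of $x$. For $n:D\to X$ in $\mathcal M'/X$ and $m:A\to X$ in $\mathcal M/X$, put $n\otimes_X m:=\pi_0(D\times_X A)\in\mathcal S$ and $\mathrm{ten}_X(n,m):=\mathcal C(1,n\otimes_X m)\in\mathbf{Set}$.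 This is a functor $\mathcal M'/X\times\mathcal M/X\to\mathbf{Set}$, regarded as a bimodule $(\mathcal M'/X)^{op}\to\mathcal M/X$ whose arrows $n\to m$ are the elements of $\mathrm{ten}_X(n,m)$. An element $s\in\mathrm{ten}_X(n,m)$ is bicartesian if both (a) for all $m'\in\mathcal M/X$ the map $\mathcal M/X(m,m')\to\mathrm{ten}_X(n,m')$, $g\mapsto\mathrm{ten}_X(n,g)(s)$, is a bijection, and (b) for all $n'\in\mathcal M'/X$ the map $\mathcal M'/X(n,n')\to\mathrm{ten}_X(n',m)$, $h\mapsto\mathrm{ten}_X(h,m)(s)$, is a bijection. *)

(* Defs.v *)
From mathcomp Require Import all_boot boolp.

Set Implicit Arguments.
Unset Strict Implicit.
Unset Printing Implicit Defensive.

Declare Scope cat_scope.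
Delimit Scope cat_scope with cat.
Local Open Scope cat_scope.

Reserved Notation "g ∘ f" (at level 40, left associativity).

Record category := Category {
  ob :> Type;
  hom : ob -> ob -> Type;
  idm : forall A, hom A A;
  cmp : forall A B D, hom B D -> hom A B -> hom A D;
  cmp1m : forall A B (f : hom A B), cmp (idm B) f = f;
  cmpm1 : forall A B (f : hom A B), cmp f (idm A) = f;
  cmpA : forall A B D K (h : hom D K) (g : hom B D) (f : hom A B),
    cmp h (cmp g f) = cmp (cmp h g) f }.

Arguments hom {c} A B.
Arguments idm {c} A.
Arguments cmp {c A B D} g f.

Notation "g ∘ f" := (cmp g f) : cat_scope.

Record functor (C D : category) := Functor {
  fob :> C -> D;
  fmap : forall A B, hom A B -> hom (fob A) (fob B);
  fmap_id : forall A, fmap (idm A) = idm (fob A);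
  fmap_cmp : forall A B K (g : hom B K) (f : hom A B),
    fmap (g ∘ f) = fmap g ∘ fmap f }.

Arguments fmap {C D} F {A B} f : rename.

Definition functor_comp (C D K : category) (G : functor D K) (F : functor C D) :
  functor C K.
Proof.
by exists (fun A => G (F A)) (fun A B f => fmap G (fmap F f)) => *;
  rewrite ?fmap_id ?fmap_cmp.
Defined.

Definition prod_cat (C D : category) : category.
Proof.
exists (C * D)%type (fun A B => hom A.1 B.1 * hom A.2 B.2)%type
  (fun A => (idm A.1, idm A.2)) (fun A B K g f => (g.1 ∘ f.1, g.2 ∘ f.2)).
- by move=> A B [f g] /=; rewrite !cmp1m.
- by move=> A B [f g] /=; rewrite !cmpm1.
- by move=> A B D' K h g f /=; rewrite !cmpA.
Defined.

Definition sets : category.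
Proof.
by exists Type (fun A B => A -> B) (fun A x => x) (fun A B D g f x => g (f x)).
Defined.

Definition hom_functor (C : category) (T : C) : functor C sets.
Proof.
exists (fun A => hom T A : sets) (fun A B f (s : hom T A) => f ∘ s).
- by move=> A; apply: funext => s; rewrite cmp1m.
- by move=> A B K g f; apply: funext => s; rewrite /= cmpA.
Defined.

Definition full_sub (C : category) (P : C -> Prop) : category.
Proof.
exists {A : C | P A} (fun A B => hom (sval A) (sval B)) (fun A => idm (sval A))
  (fun A B D g f => g ∘ f).
- by move=> *; rewrite cmp1m.
- by move=> *; rewrite cmpm1.
- by move=> *; rewrite cmpA.
Defined.

Definition full_sub_incl (C : category) (P : C -> Prop) :
  functor (full_sub P) C.
Proof. by exists (fun A : full_sub P => sval A) (fun A B f => f). Defined.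

Section Slice.
Variables (C : category) (X : C).

Definition slice_ob := {A : C & hom A X}.

Definition slice_hom (p q : slice_ob) :=
  {f : hom (projT1 p) (projT1 q) | projT2 q ∘ f = projT2 p}.

Definition slice_id (p : slice_ob) : slice_hom p p :=
  exist _ (idm (projT1 p)) (cmpm1 (projT2 p)).

Lemma slice_cmp_subproof (p q r : slice_ob)
    (g : slice_hom q r) (f : slice_hom p q) :
  projT2 r ∘ (sval g ∘ sval f) = projT2 p.
Proof. by rewrite cmpA (svalP g) (svalP f). Qed.

Definition slice_cmp (p q r : slice_ob)
    (g : slice_hom q r) (f : slice_hom p q) : slice_hom p r :=
  exist _ (sval g ∘ sval f) (slice_cmp_subproof g f).

Definition slice : category.
Proof.
exists slice_ob slice_hom slice_id slice_cmp.
- by move=> p q [f hf]; apply: eq_exist; rewrite /= cmp1m.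
- by move=> p q [f hf]; apply: eq_exist; rewrite /= cmpm1.
- by move=> p q r t h g f; apply: eq_exist; rewrite /= cmpA.
Defined.

End Slice.

Definition slice_dom (C : category) (X : C) : functor (slice X) C.
Proof.
by exists (fun p : slice_ob X => projT1 p) (fun p q (f : slice_hom p q) => sval f).
Defined.

Definition left_adjoint (C D : category) (F : functor C D) (G : functor D C) :=
  exists phi : forall (A : C) (B : D), hom (F A) B -> hom A (G B),
    [/\ forall A B, bijective (@phi A B),
        forall A A' B (f : hom A' A) (g : hom (F A) B),
          phi A' B (g ∘ fmap F f) = phi A B g ∘ f
      & forall A B B' (g : hom (F A) B) (k : hom B B'),
          phi A B' (k ∘ g) = fmap G k ∘ phi A B g].

Definition is_terminal (C : category) (T : C) :=
  forall A : C, exists! f : hom A T, True.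

(** [is_pullback f g p q] is about the square [f ∘ p = g ∘ q]; [p] is then the
    pullback of [g] along [f], and [q] the pullback of [f] along [g]. *)
Definition is_pullback (C : category) (A B X P : C)
    (f : hom A X) (g : hom B X) (p : hom P A) (q : hom P B) :=
  f ∘ p = g ∘ q /\
  forall (T : C) (a : hom T A) (b : hom T B), f ∘ a = g ∘ b ->
    exists! u : hom T P, p ∘ u = a /\ q ∘ u = b.

(** All finite limits, given by a terminal object and pullbacks. *)
Record finite_limits (C : category) := FiniteLimits {
  one : C;
  one_terminal : is_terminal one;
  pb : forall A B X : C, hom A X -> hom B X -> C;
  pb1 : forall (A B X : C) (f : hom A X) (g : hom B X), hom (pb f g) A;
  pb2 : forall (A B X : C) (f : hom A X) (g : hom B X), hom (pb f g) B;
  pb_pullback : forall (A B X : C) (f : hom A X) (g : hom B X),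
    is_pullback f g (pb1 f g) (pb2 f g) }.

Definition arrow_class (C : category) := forall A B : C, hom A B -> Prop.

Definition orthogonal (C : category) (A B K L : C) (e : hom A B) (m : hom K L) :=
  forall (u : hom A K) (v : hom B L), m ∘ u = v ∘ e ->
    exists! d : hom B K, d ∘ e = u /\ m ∘ d = v.

Definition factorization_system (C : category) (E M : arrow_class C) :=
  [/\ forall (A B : C) (f : hom A B), exists K (e : hom A K) (m : hom K B),
        [/\ E _ _ e, M _ _ m & m ∘ e = f],
      forall (A B : C) (e : hom A B), E _ _ e <->
        forall (K L : C) (m : hom K L), M _ _ m -> orthogonal e m
    & forall (K L : C) (m : hom K L), M _ _ m <->
        forall (A B : C) (e : hom A B), E _ _ e -> orthogonal e m].

Definition stable_along (C : category) (E N : arrow_class C) :=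
  forall (A B X P : C) (f : hom A X) (g : hom B X) (p : hom P A) (q : hom P B),
    is_pullback f g p q -> E _ _ f -> N _ _ g -> E _ _ q.

Record bfc := Bfc {
  bfc_cat :> category;
  bfc_lim : finite_limits bfc_cat;
  bfcE : arrow_class bfc_cat;
  bfcM : arrow_class bfc_cat;
  bfcE' : arrow_class bfc_cat;
  bfcM' : arrow_class bfc_cat;
  bfc_fs : factorization_system bfcE bfcM;
  bfc_fs' : factorization_system bfcE' bfcM';
  bfc_stable : stable_along bfcE bfcM';
  bfc_stable' : stable_along bfcE' bfcM }.

Definition pt (C : bfc) : C := one (bfc_lim C).

Definition slice_class (C : category) (M : arrow_class C) (X : C) : category :=
  full_sub (fun p : slice X => M _ _ (projT2 p)).

Definition Mover (C : bfc) (X : C) : category := slice_class (@bfcM C) X.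
Definition M'over (C : bfc) (X : C) : category := slice_class (@bfcM' C) X.

(** [M/1] and [M'/1] are full subcategories of [C/1], so they are equal exactly
    when they have the same objects. *)
Definition strong (C : bfc) :=
  forall (A : C) (f : hom A (pt C)), bfcM f <-> bfcM' f.

Definition Scat (C : bfc) : category := Mover (pt C).

Definition Sincl (C : bfc) : functor (Scat C) C :=
  functor_comp (slice_dom (pt C)) (full_sub_incl _).

Definition second_factor (C : category) (E M : arrow_class C) (T X : C)
    (x : hom T X) (m : slice_class M X) :=
  exists2 e : hom T (projT1 (sval m)), E _ _ e & projT2 (sval m) ∘ e = x.

(** The slice projection [↓x] and the coslice projection [↑x] are only defined
    up to isomorphism: [is_down x m] says that [m] is one choice of [↓x], and
    [is_up x n] that [n] is one choice of [↑x]. *)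
Definition is_down (C : bfc) (X : C) (x : hom (pt C) X) (m : Mover X) :=
  second_factor (@bfcE C) x m.

Definition is_up (C : bfc) (X : C) (x : hom (pt C) X) (n : M'over X) :=
  second_factor (@bfcE' C) x n.

Section Tensor.
Variables (C : bfc) (X : C).

Definition fibprod (nm : prod_cat (M'over X) (Mover X)) : C :=
  pb (bfc_lim C) (projT2 (sval nm.1)) (projT2 (sval nm.2)).

Definition fibprod1 nm : hom (fibprod nm) (projT1 (sval nm.1)) := pb1 _ _ _.
Definition fibprod2 nm : hom (fibprod nm) (projT1 (sval nm.2)) := pb2 _ _ _.

Lemma fibprod_map_subproof (nm nm' : prod_cat (M'over X) (Mover X))
    (hg : hom nm nm') :
  exists! u : hom (fibprod nm) (fibprod nm'),
    fibprod1 nm' ∘ u = sval hg.1 ∘ fibprod1 nm /\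
    fibprod2 nm' ∘ u = sval hg.2 ∘ fibprod2 nm.
Proof.
have [_] := pb_pullback (bfc_lim C) (projT2 (sval nm'.1)) (projT2 (sval nm'.2)).
apply; rewrite !cmpA (svalP hg.1) (svalP hg.2).
by have [] := pb_pullback (bfc_lim C) (projT2 (sval nm.1)) (projT2 (sval nm.2)).
Qed.

Definition fibprod_map nm nm' (hg : hom nm nm') :
    hom (fibprod nm) (fibprod nm') :=
  sval (cid (fibprod_map_subproof hg)).

Lemma fibprod_mapP nm nm' (hg : hom nm nm') :
  fibprod1 nm' ∘ fibprod_map hg = sval hg.1 ∘ fibprod1 nm /\
  fibprod2 nm' ∘ fibprod_map hg = sval hg.2 ∘ fibprod2 nm.
Proof. by rewrite /fibprod_map; case: (cid _) => u []. Qed.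

Lemma fibprod_map_unique nm nm' (hg : hom nm nm') u :
  fibprod1 nm' ∘ u = sval hg.1 ∘ fibprod1 nm ->
  fibprod2 nm' ∘ u = sval hg.2 ∘ fibprod2 nm ->
  fibprod_map hg = u.
Proof.
move=> u1 u2; rewrite /fibprod_map; case: (cid _) => v [_ /= v_unique].
exact: v_unique.
Qed.

Definition fibprod_functor : functor (prod_cat (M'over X) (Mover X)) C.
Proof.
exists fibprod fibprod_map.
- by move=> nm; apply: fibprod_map_unique; rewrite cmpm1 /= cmp1m.
- move=> A B K g f; have [f1 f2] := fibprod_mapP f.
  have [g1 g2] := fibprod_mapP g.
  by apply: fibprod_map_unique; rewrite cmpA ?g1 ?g2 -cmpA ?f1 ?f2 cmpA.
Defined.

Variable pi0 : functor C (Scat C).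

Definition tensor : functor (prod_cat (M'over X) (Mover X)) (Scat C) :=
  functor_comp pi0 fibprod_functor.

Definition ten : functor (prod_cat (M'over X) (Mover X)) sets :=
  functor_comp (hom_functor (pt C)) (functor_comp (Sincl C) tensor).

End Tensor.

(** A functor [N × M -> Set] is seen as a bimodule [N^op -> M], whose arrows
    [n -> m] are the elements of [B (n, m)]. *)
Definition bicartesian (N M : category) (B : functor (prod_cat N M) sets)
    (n : N) (m : M) (s : B (n, m)) :=
  (forall m' : M, bijective (fun g : hom m m' =>
     @fmap _ _ B (n, m) (n, m') (idm n, g) s)) /\
  (forall n' : N, bijective (fun h : hom n n' =>
     @fmap _ _ B (n, m) (n', m) (h, idm m) s)).

(* Main.v *)
(** Write [P = D ×_X A'] for a coslice projection [n : D -> X] of [x], with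
    [e' : 1 -> D] in [E'], and some [m' : A' -> X] in [M]. The pullback [Q] of
    [P -> D] along [e'] lies in [M/1 = M'/1], while reciprocal stability puts
    [k : Q -> P] in [E']. Hence [P] and [Q] have the same maps into objects of
    [S], so that [Q -> P -> π0 P] is an isomorphism. The points of [π0 P] are
    therefore the points of [Q], that is the points of [A'] over [x], and since
    [1 -> A] is in [E], these are the maps [↓x -> m']. Exchanging the two
    factorization systems gives the other half of bicartesianness, for the same
    element: the image in [π0 (D ×_X A)] of the canonical point of [D ×_X A]. *)
From mathcomp Require Import all_boot boolp.
Require Import Defs.

Set Implicit Arguments.
Unset Strict Implicit.
Unset Printing Implicit Defensive.

Local Open Scope cat_scope.

Lemma bijective_of_unique (T U : Type) (f : T -> U) :
  (forall y, exists! x, f x = y) -> bijective f.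
Proof.
move=> h; exists (fun y => sval (cid (h y))) => y.
  by case: cid => z [_ /=]; apply.
by case: cid => z [].
Qed.

Lemma terminal_eq (C : category) (T : C) (hT : is_terminal T) (A : C)
    (f g : hom A T) : f = g.
Proof. by have [h [_ h_uniq]] := hT A; rewrite -(h_uniq f) // -(h_uniq g). Qed.

Section Pullback.
Variables (C : category) (A B X P : C).
Variables (f : hom A X) (g : hom B X) (p : hom P A) (q : hom P B).

Lemma is_pullback_sym : is_pullback f g p q -> is_pullback g f q p.
Proof.
move=> [sq univ]; split=> // T a b eq_ab.
have [u [[pu qu] u_uniq]] := univ T b a (esym eq_ab).
by exists u; split=> // v [qv pv]; apply: u_uniq.
Qed.

Hypothesis pbP : is_pullback f g p q.

Lemma pullback_ext (T : C) (u v : hom T P) :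
  p ∘ u = p ∘ v -> q ∘ u = q ∘ v -> u = v.
Proof.
case: pbP => sq univ pE qE.
have [|w [_ w_uniq]] := univ T (p ∘ v) (q ∘ v); first by rewrite !cmpA sq.
by rewrite -(w_uniq u) // -(w_uniq v).
Qed.

(** A filler for the square pasted onto [g] supplies the [B]-component of the required filler, and
    [v] supplies its [A]-component. *)
Lemma pullback_right_class (E M : arrow_class C) :
  factorization_system E M -> M _ _ g -> M _ _ p.
Proof.
move=> [_ _ rightP] Mg; case: (pbP) => sq univ.
apply/rightP => K L e Ee u v uv.
have [|d [[de gd] d_uniq]] := (rightP _ _ g).1 Mg _ _ e Ee (q ∘ u) (f ∘ v).
  by rewrite cmpA -sq -!cmpA uv.
have [w [[pw qw] w_uniq]] := univ L v d (esym gd).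
exists w; split.
  by split=> //; apply: pullback_ext; rewrite cmpA ?pw ?qw.
move=> w' [w'e pw']; apply: w_uniq; split=> //.
by apply/esym/d_uniq; rewrite -cmpA w'e cmpA -sq -cmpA pw'.
Qed.

End Pullback.

Section Reflection.
Variables (C : category) (lim : finite_limits C).
Variables (E M E' M' : arrow_class C).
Hypotheses (fs : factorization_system E M) (fs' : factorization_system E' M').
Hypothesis stable' : stable_along E' M.
Hypothesis MM' : forall (A : C) (f : hom A (one lim)), M f <-> M' f.

(** Phrased through one class [M] rather than an adjunction, so that it applies to either
    factorization system. As [one lim] is terminal, the first clause concerns a single map. *)
Definition is_reflection (A R : C) (eta : hom A R) :=
  (forall f : hom R (one lim), M f) /\
  forall (S : C) (f : hom S (one lim)), M f ->
    forall h : hom A S, exists! t : hom R S, t ∘ eta = h.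

Lemma left_class_extension (Q P S : C) (k : hom Q P) (f : hom S (one lim)) :
  E' k -> M f -> forall u : hom Q S, exists! d : hom P S, d ∘ k = u.
Proof.
case: fs' => _ _ rightP Ek Mf u.
have [v _] := one_terminal lim P.
have [|d [[dk _] d_uniq]] := (rightP _ _ f).1 ((MM' f).1 Mf) _ _ k Ek u v.
  exact: (terminal_eq (one_terminal lim)).
exists d; split=> // d' d'k; apply: d_uniq; split=> //.
exact: (terminal_eq (one_terminal lim)).
Qed.

(** [Q] and [R] both represent the maps from [P] to objects of the subcategory: [Q] by unique
    extension along [k], [R] by reflection. The inverse [t] comes from extending [idm Q] along [k]
    and factoring the result through [eta]. *)
Lemma reflection_left_class_iso (Q P R : C) (k : hom Q P) (eta : hom P R)
    (f : hom Q (one lim)) :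
  E' k -> M f -> is_reflection eta ->
  exists t : hom R Q, t ∘ (eta ∘ k) = idm Q /\ (eta ∘ k) ∘ t = idm R.
Proof.
move=> Ek Mf [MR reflR].
have [fR _] := one_terminal lim R.
have [d [dk _]] := left_class_extension Ek Mf (idm Q).
have [t [t_eta _]] := reflR _ _ Mf d.
exists t; split; first by rewrite cmpA t_eta.
have [w [_ w_uniq]] := reflR _ _ (MR fR) eta.
have [z [_ z_uniq]] := left_class_extension Ek (MR fR) (eta ∘ k).
have eta_kd : (eta ∘ k) ∘ d = eta.
  by rewrite -[RHS](z_uniq eta) //; apply/esym/z_uniq; rewrite -!cmpA dk cmpm1.
rewrite -(w_uniq (idm R)) ?cmp1m //; apply/esym/w_uniq.
by rewrite -cmpA t_eta.
Qed.

(** Points of [P] over [e'] are points of the pullback [Q] of [p] along [e'], and [Q] is isomorphic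
    to [R] through [eta ∘ k]. *)
Lemma points_of_reflection (D P R : C) (e' : hom (one lim) D) (p : hom P D)
    (eta : hom P R) :
  E' e' -> M p -> is_reflection eta ->
  forall r : hom (one lim) R,
    exists! u : hom (one lim) P, p ∘ u = e' /\ eta ∘ u = r.
Proof.
move=> Ee' Mp reflR r.
have pbQ := pb_pullback lim e' p.
set k := pb2 lim e' p in pbQ; set f := pb1 lim e' p in pbQ.
have [sq univ] := pbQ.
have Ek : E' k by apply: stable' pbQ Ee' Mp.
have Mf : M f by apply: pullback_right_class pbQ _ _ fs Mp.
have [t [tk kt]] := reflection_left_class_iso Ek Mf reflR.
have point_id (g : hom (one lim) (one lim)) : g = idm _.
  exact: (terminal_eq (one_terminal lim)).
exists (k ∘ (t ∘ r)); split.
  split; first by rewrite cmpA -sq -cmpA (point_id (f ∘ _)) cmpm1.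
  by rewrite !cmpA kt cmp1m.
move=> u [pu eta_u].
have [|v [[_ kv] _]] := univ _ (idm _) u; first by rewrite cmpm1.
by rewrite -eta_u -kv [eta ∘ _]cmpA [t ∘ _]cmpA tk cmp1m.
Qed.

(** Orthogonality of [e] and [m'] makes a map [g] over [X] the same as the point [g ∘ e] of [A']
    over [x], hence as a point of [P] over [e']. Quantifying over [u] describes that point without
    naming a pairing. *)
Lemma slice_maps_of_reflection (X D A A' P R : C) (x : hom (one lim) X)
    (n : hom D X) (m : hom A X) (m' : hom A' X)
    (e' : hom (one lim) D) (e : hom (one lim) A)
    (p : hom P D) (q : hom P A') (eta : hom P R) :
  E' e' -> n ∘ e' = x -> E e -> m ∘ e = x -> M m' ->
  is_pullback n m' p q -> is_reflection eta ->
  forall r : hom (one lim) R,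
    exists! g : slice_hom (existT (fun B => hom B X) A m) (existT _ A' m'),
      forall u : hom (one lim) P,
        p ∘ u = e' -> q ∘ u = sval g ∘ e -> eta ∘ u = r.
Proof.
move=> Ee' ne' Ee me Mm' pbP reflR r.
have [sq univ] := pbP; have [_ _ rightP] := fs.
have Mp : M p by apply: pullback_right_class pbP _ _ fs Mm'.
have [u [[pu eta_u] u_uniq]] := points_of_reflection Ee' Mp reflR r.
have [|g [[ge m'g] g_uniq]] := (rightP _ _ m').1 Mm' _ _ e Ee (q ∘ u) m.
  by rewrite cmpA -sq -cmpA pu ne' me.
exists (exist _ g m'g); split=> /=.
  move=> v pv qv; suff -> : v = u by [].
  by apply: (pullback_ext pbP); rewrite ?pv ?pu // qv ge.
move=> [g' /= m'g'] g'P; apply: eq_exist => /=.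
have [|v [[pv qv] _]] := univ _ e' (g' ∘ e).
  by rewrite cmpA m'g' ne' me.
apply: g_uniq; split=> //; rewrite -qv (u_uniq v) //; split=> //.
exact: g'P.
Qed.

End Reflection.

Theorem proposition9p3 (C : bfc) (hC : strong C)
    (pi0 : functor C (Scat C)) (hpi0 : left_adjoint pi0 (Sincl C))
    (X : C) (x : hom (pt C) X)
    (up : M'over X) (down : Mover X)
    (hup : is_up x up) (hdown : is_down x down) :
  exists s : ten X pi0 (up, down), bicartesian s.
Proof.
have [phi [phi_bij phi_natl phi_natr]] := hpi0.
have [e' Ee' ne'] := hup; have [e Ee me] := hdown.
(* The unit of the adjunction. *)
pose eta (A : C) : hom A (Sincl C (pi0 A)) := phi _ _ (idm (pi0 A)).
have eta_nat (A B : C) (f : hom A B) :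
    fmap (Sincl C) (fmap pi0 f) ∘ eta A = eta B ∘ f.
  by rewrite /eta -phi_natr cmpm1 -phi_natl cmp1m.
have eta_refl (A : C) : is_reflection (bfc_lim C) (@bfcM C) (eta A).
  split=> [f | S f Mf h].
    rewrite (terminal_eq (one_terminal (bfc_lim C)) f (projT2 (sval (pi0 A)))).
    exact: (svalP (pi0 A)).
  pose S' : Scat C := exist _ (existT _ S f) Mf.
  have [psi phiK psiK] := phi_bij A S'.
  have phiE (g : hom (pi0 A) S') : phi A S' g = fmap (Sincl C) g ∘ eta A.
    by rewrite -phi_natr cmpm1.
  exists (fmap (Sincl C) (psi h)); split; first by rewrite -phiE psiK.
  move=> t t_eta.
  (* Any map between the underlying objects lies over the terminal object, so [t] is a morphism of
     [Scat C]. *)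
  have tP : projT2 (sval S') ∘ t = projT2 (sval (pi0 A)).
    exact: (terminal_eq (one_terminal (bfc_lim C))).
  pose t' : hom (pi0 A) S' := exist _ t tP.
  suff -> : psi h = t' by [].
  by apply: (can_inj phiK); rewrite psiK phiE.
have eta_refl' (A : C) : is_reflection (bfc_lim C) (@bfcM' C) (eta A).
  case: (eta_refl A) => MR reflR; split=> [f | S f M'f]; first exact/hC.
  by apply: (reflR S f); apply/hC.
have pbP (n : M'over X) (m : Mover X) :=
  pb_pullback (bfc_lim C) (projT2 (sval n)) (projT2 (sval m)).
pose ud : prod_cat (M'over X) (Mover X) := (up, down).
have [u0 [[pu0 qu0] _]] : exists! u : hom (pt C) (fibprod ud),
    fibprod1 ud ∘ u = e' /\ fibprod2 ud ∘ u = e.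
  by have [_] := pbP up down; apply; rewrite ne' me.
(* Naturality of [eta] moves the action of [ten] onto the point [u0]. *)
have tenE nm (hg : hom ud nm) :
    fmap (ten X pi0) hg (eta (fibprod ud) ∘ u0) =
    eta (fibprod nm) ∘ (fibprod_map hg ∘ u0).
  by rewrite [LHS]cmpA eta_nat -cmpA.
have pointE nm (hg : hom ud nm) :
    fibprod1 nm ∘ (fibprod_map hg ∘ u0) = sval hg.1 ∘ e' /\
    fibprod2 nm ∘ (fibprod_map hg ∘ u0) = sval hg.2 ∘ e.
  by have [w1 w2] := fibprod_mapP hg; rewrite !cmpA w1 w2 -!cmpA pu0 qu0.
exists (eta (fibprod ud) ∘ u0); split=> [m' | n'];
  apply: bijective_of_unique => r.
- have [g [gP g_uniq]] := slice_maps_of_reflection (bfc_fs C) (bfc_fs' C)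
    (@bfc_stable' C) hC Ee' ne' Ee me (svalP m') (pbP up m') (eta_refl _) r.
  exists (g : hom down m'); split.
    have [w1 w2] := pointE (up, m') (idm up, g).
    by rewrite tenE; apply: gP; rewrite // w1 cmp1m.
  move=> h; rewrite tenE => hr; apply: g_uniq => v pv qv; rewrite -hr.
  have [w1 w2] := pointE (up, m') (idm up, h).
  by congr (_ ∘ _); apply: (pullback_ext (pbP up m'));
    rewrite ?pv ?qv ?w1 ?w2 ?cmp1m.
(* The same lemma with the two systems exchanged: the pullback square is transposed and strongness
   is read backwards. *)
- have [g [gP g_uniq]] := slice_maps_of_reflection (bfc_fs' C) (bfc_fs C)
    (@bfc_stable C) (fun A f => iff_sym (hC A f)) Ee me Ee' ne' (svalP n')
    (is_pullback_sym (pbP n' down)) (eta_refl' _) r.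
  exists (g : hom up n'); split.
    have [w1 w2] := pointE (n', down) (g, idm down).
    by rewrite tenE; apply: gP; rewrite // w2 cmp1m.
  move=> h; rewrite tenE => hr; apply: g_uniq => v pv qv; rewrite -hr.
  have [w1 w2] := pointE (n', down) (h, idm down).
  by congr (_ ∘ _); apply: (pullback_ext (pbP n' down));
    rewrite ?pv ?qv ?w1 ?w2 ?cmp1m.
Qed.
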